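(* The category $\mathbf{MetCH_{sep}}$ is Barr-coexact, i.e. its opposite category $\mathbf{MetCH_{sep}}^{\mathrm{op}}$ is a Barr-exact category.
   Context: A metric on a set $X$ is a map $d\colon X\times X\to[0,\infty]$ (not necessarily symmetric, the value $\infty$ allowed) with $d(x,x)=0$ and $d(x,z)\le d(x,y)+d(y,z)$ for all $x,y,z$; it is separated if $d(x,y)=0=d(y,x)$ implies $x=y$. The upper topology on $[0,\infty]$ is the topology whose nonempty proper open sets are the sets $]u,\infty]$, $u\in[0,\infty]$. A separated metric compact Hausdorff space is a compact Hausdorff space $X$ together with a separated metric $d$ on $X$ that is continuous as a map $X\times X\to[0,\infty]$ (product topology on $X\times X$, upper topology on $[0,\infty]$). $\mathbf{MetCH_{sep}}$ is the category of separated metric compact Hausdorff spaces and continuous non-expansive maps ($d_Y(f(x),f(y))\le d_X(x,y)$). A category is regular if it is finitely complete, has coequalisers of kernel pairs, and regular epimorphisms are stable under pullback; it is Barr-exact if it is regular and every internal equivalence relation is effective, i.e. is the kernel pair of some morphism. *)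

(* Defs.v *)
From HB Require Import structures.
From mathcomp Require Import all_boot all_order all_algebra.
From mathcomp Require Import all_classical all_reals.
From mathcomp Require Import topology ereal.
From mathcomp Require Import Rstruct.
From Stdlib Require Import Rdefinitions.

Set Implicit Arguments.
Unset Strict Implicit.
Unset Printing Implicit Defensive.

Import Order.TTheory GRing.Theory Num.Theory.
Local Open Scope classical_set_scope.
Local Open Scope ereal_scope.

Record category := Category {
  ob :> Type;
  hom : ob -> ob -> Type;
  idc : forall a, hom a a;
  comp : forall x y z, hom y z -> hom x y -> hom x z;
  comp1h : forall a b (f : hom a b), comp (idc b) f = f;
  comph1 : forall a b (f : hom a b), comp f (idc a) = f;
  compA : forall a b c d (f : hom c d) (g : hom b c) (h : hom a b),
      comp f (comp g h) = comp (comp f g) h }.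

Arguments hom {c} : rename.
Arguments idc {c} : rename.
Arguments comp {c x y z} : rename.

Definition op (C : category) : category :=
  @Category (ob C) (fun a b => @hom C b a) (@idc C)
    (fun a b c (f : @hom C c b) (g : @hom C b a) => comp g f)
    (fun a b f => comph1 f) (fun a b f => comp1h f)
    (fun a b c d f g h => esym (compA h g f)).

Section CategoryNotions.
Variable C : category.

Definition is_terminal (t : C) : Prop :=
  forall a : C, exists! f : hom a t, True.

Definition is_pullback (a b c : C) (f : hom a c) (g : hom b c)
    (p : C) (p1 : hom p a) (p2 : hom p b) : Prop :=
  comp f p1 = comp g p2 /\
  forall (q : C) (q1 : hom q a) (q2 : hom q b), comp f q1 = comp g q2 ->
    exists! u : hom q p, comp p1 u = q1 /\ comp p2 u = q2.

Definition has_pullbacks : Prop :=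
  forall (a b c : C) (f : hom a c) (g : hom b c),
    exists (p : C) (p1 : hom p a) (p2 : hom p b), is_pullback f g p1 p2.

Definition finitely_complete : Prop :=
  (exists t : C, is_terminal t) /\ has_pullbacks.

Definition is_coequaliser (a b c : C) (f g : hom a b) (e : hom b c) : Prop :=
  comp e f = comp e g /\
  forall (d : C) (h : hom b d), comp h f = comp h g ->
    exists! u : hom c d, comp u e = h.

Definition is_kernel_pair (a b : C) (f : hom a b)
    (k : C) (k1 k2 : hom k a) : Prop := is_pullback f f k1 k2.

Definition is_regular_epi (b c : C) (e : hom b c) : Prop :=
  exists (a : C) (f g : hom a b), is_coequaliser f g e.

Definition has_coequalisers_of_kernel_pairs : Prop :=
  forall (a b : C) (f : hom a b) (k : C) (k1 k2 : hom k a),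
    is_kernel_pair f k1 k2 -> exists (c : C) (e : hom a c), is_coequaliser k1 k2 e.

Definition regular_epis_pullback_stable : Prop :=
  forall (a b c : C) (e : hom a c) (g : hom b c)
         (p : C) (p1 : hom p a) (p2 : hom p b),
    is_regular_epi e -> is_pullback e g p1 p2 -> is_regular_epi p2.

Definition regular_category : Prop :=
  [/\ finitely_complete, has_coequalisers_of_kernel_pairs
    & regular_epis_pullback_stable].

Definition is_equivalence_relation (x r : C) (r1 r2 : hom r x) : Prop :=
  [/\
      (forall (z : C) (g h : hom z r),
          comp r1 g = comp r1 h -> comp r2 g = comp r2 h -> g = h),
      (exists d : hom x r, comp r1 d = idc x /\ comp r2 d = idc x),
      (exists s : hom r r, comp r1 s = r2 /\ comp r2 s = r1)
    &
      (forall (p : C) (p1 p2 : hom p r), is_pullback r2 r1 p1 p2 ->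
         exists t : hom p r, comp r1 t = comp r1 p1 /\ comp r2 t = comp r2 p2)].

Definition is_effective (x r : C) (r1 r2 : hom r x) : Prop :=
  exists (y : C) (f : hom x y), is_kernel_pair f r1 r2.

Definition barr_exact : Prop :=
  regular_category /\
  forall (x r : C) (r1 r2 : hom r x),
    is_equivalence_relation r1 r2 -> is_effective r1 r2.

End CategoryNotions.

Definition barr_coexact (C : category) : Prop := barr_exact (op C).

Record metCHsep := MetCHsep {
  mcar :> topologicalType;
  mdist : mcar -> mcar -> \bar Rdefinitions.R;
  mdist_ge0 : forall x y, 0 <= mdist x y;
  mdist_refl : forall x, mdist x x = 0;
  mdist_tri : forall x y z, mdist x z <= mdist x y + mdist y z;
  mdist_sep : forall x y, mdist x y = 0 -> mdist y x = 0 -> x = y;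
  mcompact : compact [set: mcar];
  mhausdorff : hausdorff_space mcar;
  (* continuity of d : X x X -> [0,oo] for the upper topology: preimages of
     the nonempty proper opens ]u, oo] (u in [0, oo]) are open *)
  mdist_cont : forall u : \bar Rdefinitions.R, 0 <= u ->
      open [set p : mcar * mcar | u < mdist p.1 p.2] }.

Record mhom (X Y : metCHsep) := MHom {
  mfun :> X -> Y;
  mfun_cont : continuous mfun;
  mfun_nonexp : forall x y, mdist (mfun x) (mfun y) <= mdist x y }.

Lemma mhom_eq (X Y : metCHsep) (f g : mhom X Y) : mfun f = mfun g -> f = g.
Proof.
case: f g => f fc fn [g gc gn] /= efg; subst g.
by rewrite (Prop_irrelevance fc gc) (Prop_irrelevance fn gn).
Qed.

Definition mhom_id (X : metCHsep) : mhom X X.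
Proof.
refine (@MHom X X id _ _); first by move=> x; exact: cvg_id.
by [].
Defined.

Definition mhom_comp (X Y Z : metCHsep) (g : mhom Y Z) (f : mhom X Y) : mhom X Z.
Proof.
refine (@MHom X Z (g \o f) _ _).
- by move=> x; apply: continuous_comp; [exact: mfun_cont|exact: mfun_cont].
- by move=> x y /=; apply: le_trans (mfun_nonexp g _ _) (mfun_nonexp f _ _).
Defined.

Definition MetCH_sep : category.
Proof.
refine (@Category metCHsep mhom mhom_id mhom_comp _ _ _).
- by move=> a b f; apply: mhom_eq.
- by move=> a b f; apply: mhom_eq.
- by move=> a b c d f g h; apply: mhom_eq.
Defined.

(* Main.v *)
(* Regular monomorphisms are the isometric embeddings.  Given an isometric
   e : A -> B and any g : A -> C, there is an explicit continuous metric on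
   B + C that identifies e a with g a, restricts to the metric of C, and has
   d(b, c) = min_a (d(b, e a) + d(g a, c)), the minimum being attained by
   compactness.  Hence isometric embeddings are stable under pushout, each one
   is the equaliser of its cokernel pair, and jointly epic pairs are jointly
   surjective.

   A coequivalence relation r1, r2 : X -> Y is thus a quotient of X + X, and is
   encoded by rho(x, y) = d(r1 x, r2 y), which dominates d; cotransitivity says
   rho(x, y) >= rho(x, z) + rho(z, y) for some z.  Iterating this produces a
   sequence that is Cauchy for rho, and any cluster point z of it satisfies
   rho(z, z) = 0 and rho(x, z) + rho(z, y) <= rho(x, y).  So rho is computed
   through the points where r1 and r2 agree, i.e. (r1, r2) is the cokernel pair
   of the inclusion of those points. *)
From mathcomp Require Import all_boot all_order all_algebra.
From mathcomp Require Import all_classical all_reals.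
From mathcomp Require Import topology ereal.
From mathcomp Require Import Rstruct lra.
Require Import Defs.

Set Implicit Arguments.
Unset Strict Implicit.
Unset Printing Implicit Defensive.

Import Order.TTheory GRing.Theory Num.Theory.
Local Open Scope classical_set_scope.
Local Open Scope ereal_scope.

(** * Lower semicontinuous functions *)

Lemma continuous_compT (X Y Z : topologicalType) (f : X -> Y) (g : Y -> Z) :
  continuous f -> continuous g -> continuous (fun x => g (f x)).
Proof.
by move=> fc gc x; apply: (@continuous_comp _ _ _ f g); [exact: fc|exact: gc].
Qed.

Lemma continuous_fst (X Y : topologicalType) : continuous (@fst X Y).
Proof. by move=> p; exact: cvg_fst. Qed.

Lemma continuous_snd (X Y : topologicalType) : continuous (@snd X Y).
Proof. by move=> p; exact: cvg_snd. Qed.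

Lemma continuous_pair (K X Y : topologicalType) (f : K -> X) (g : K -> Y) :
  continuous f -> continuous g -> continuous (fun x => (f x, g x)).
Proof.
move=> fc gc x.
apply: (@cvg_pair _ _ _ (nbhs x) (nbhs (f x)) (nbhs (g x)) _ _ _ f g).
- exact: fc.
- exact: gc.
Qed.

Lemma continuous_prod_map (X X' Y Y' : topologicalType)
    (f : X -> X') (g : Y -> Y') :
  continuous f -> continuous g ->
  continuous (fun p : X * Y => (f p.1, g p.2)).
Proof.
move=> fc gc; apply: continuous_pair; apply: continuous_compT => //.
- exact: continuous_fst.
- exact: continuous_snd.
Qed.

Section LowerSemicontinuity.
Variable R : realType.

(** Continuity for the upper topology in neighbourhood form, with [u] ranging over all extended
    reals; [lscP] matches it with the form used in [metCHsep]. *)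
Definition lsc (T : topologicalType) (f : T -> \bar R) :=
  forall x u, u < f x -> \forall y \near x, u < f y.

Lemma lscP (T : topologicalType) (f : T -> \bar R) : (forall x, 0 <= f x) ->
  lsc f <-> (forall u, 0 <= u -> open [set x | u < f x]).
Proof.
move=> f0; split=> [fl u u0|fo x u ufx].
  by rewrite openE => x; exact: fl.
have [u0|u0] := leP 0 u; first exact: (open_nbhs_nbhs (conj (fo u u0) ufx)).
by apply: nearW => y; exact: lt_le_trans u0 (f0 y).
Qed.

Lemma lsc_closed (T : topologicalType) (f : T -> \bar R) u :
  lsc f -> closed [set x | f x <= u].
Proof.
move=> fl; rewrite (_ : [set _ | _] = ~` [set x | u < f x]).
  by apply: open_closedC; rewrite openE => x; exact: fl.
by apply/seteqP; split=> x /=; rewrite leNgt => /negP.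
Qed.

Lemma lsc_cst (T : topologicalType) (c : \bar R) : lsc (fun _ : T => c).
Proof. by move=> x u ux; apply: nearW. Qed.

Lemma lsc_comp (S T : topologicalType) (g : S -> T) (f : T -> \bar R) :
  continuous g -> lsc f -> lsc (f \o g).
Proof. by move=> gc fl x u ux; exact: (gc x _ (fl _ _ ux)). Qed.

(** The excess [a + b - u] is shared equally between the summands. An infinite summand takes [u + 1]
    and the other one [-1], which lies strictly below any nonnegative value. *)
Lemma split_lt_adde (a b u : \bar R) : 0 <= a -> 0 <= b -> u < a + b ->
  exists v w, [/\ v < a, w < b & u <= v + w].
Proof.
move=> a0 b0; have N1 (c : \bar R) : 0 <= c -> (-1)%:E < c.
  by apply: lt_le_trans; rewrite lte_fin ltrN10.
case: u => [u| |_].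
- case: a a0 => [a| |//] a0; last first.
    move=> _; exists (u + 1)%:E, (-1)%:E; rewrite N1 // ltry; split=> //.
    by rewrite -EFinD lee_fin; lra.
  case: b b0 => [b| |//] b0; last first.
    move=> _; exists (-1)%:E, (u + 1)%:E; rewrite N1 // ltry; split=> //.
    by rewrite -EFinD lee_fin; lra.
  rewrite -EFinD lte_fin => uab.
  exists (a - (a + b - u) / 2)%:E, (b - (a + b - u) / 2)%:E.
  by rewrite !lte_fin -EFinD lee_fin; split; lra.
- by rewrite ltNge leey.
- by exists (-1)%:E, (-1)%:E; split; [exact: N1|exact: N1|exact: leNye].
Qed.

Lemma lsc_add (T : topologicalType) (f g : T -> \bar R) :
  (forall x, 0 <= f x) -> (forall x, 0 <= g x) -> lsc f -> lsc g ->
  lsc (fun x => f x + g x).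
Proof.
move=> f0 g0 fl gl x u /(split_lt_adde (f0 x) (g0 x)) [v [w [vf wg uvw]]].
near=> y; apply: le_lt_trans uvw _; apply: lteD.
- by near: y; exact: fl.
- by near: y; exact: gl.
Unshelve. all: by end_near. Qed.

Lemma lsc_min (T : topologicalType) (f g : T -> \bar R) :
  lsc f -> lsc g -> lsc (fun x => Order.min (f x) (g x)).
Proof.
move=> fl gl x u; rewrite lt_min => /andP[uf ug]; near=> y.
rewrite lt_min; apply/andP; split; near: y; [exact: fl|exact: gl].
Unshelve. all: by end_near. Qed.

Lemma lsc_sup (T : topologicalType) (F : set (T -> \bar R)) :
  (forall f, F f -> lsc f) -> lsc (fun x => ereal_sup [set f x | f in F]).
Proof.
move=> Fl x u /ereal_sup_gt [_ [f Ff <-] uf].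
near=> y; apply: (@lt_le_trans _ _ (f y)).
  by near: y; exact: Fl.
by apply: ereal_sup_ubound; exists f.
Unshelve. all: by end_near. Qed.

(** If a finite infimum were not attained, each point would have a neighbourhood on which [f] stays
    above some real exceeding it; compactness makes that real uniform, a contradiction. The value
    [+oo] covers the empty space. *)
Lemma lsc_compact_inf (Z : topologicalType) (f : Z -> \bar R) :
  compact [set: Z] -> (forall z, 0 <= f z) -> lsc f ->
  ereal_inf (range f) = +oo \/ exists z, ereal_inf (range f) = f z.
Proof.
move=> cZ f0 fl; set m := ereal_inf _.
have m0 : 0 <= m by apply: le_ereal_inf_tmp => _ [z _ <-].
have mle z : m <= f z by apply: ereal_inf_lbound; exists z.
have [|] := pselect (exists z, m = f z); first by right.
move=> /forallNP nm.
have mlt z : m < f z by rewrite lt_neqAle mle andbT; apply/eqP; exact: nm.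
left; case mE : m => [r| |]; [exfalso|by []|by rewrite mE in m0].
rewrite mE in mlt.
have H : \forall v \near (r^'+)%classic, [set: Z] `<=` (fun z => v%:E < f z).
  apply: ((compact_near_coveringP _).1 cZ) => z _.
  have [w [rw wf]] : exists w : R, (r < w)%R /\ w%:E < f z.
    case: (f z) (mlt z) => [a| |//].
      rewrite lte_fin => ra; exists ((r + a) / 2)%R.
      by rewrite lte_fin; split; lra.
    by exists (r + 1)%R; rewrite ltry; split=> //; lra.
  near=> z' v => /=; apply: (@lt_trans _ _ w%:E).
    by rewrite lte_fin; near: v; exact: nbhs_right_lt.
  by near: z'; exact: fl.
have [v [Hv rv]] := filter_ex (filterI H (nbhs_right_gt r)).
have : v%:E <= m.
  by apply: le_ereal_inf_tmp => _ [z _ <-]; apply: ltW; exact: Hv.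
by rewrite mE lee_fin leNgt rv.
Unshelve. all: by end_near. Qed.

(** A tube argument: compactness of [Z] makes the neighbourhood of [t] uniform in [z], and the
    strict inequality survives the infimum because a finite infimum is attained. *)
Lemma lsc_inf (Z T : topologicalType) (f : Z -> T -> \bar R) :
  compact [set: Z] -> (forall z t, 0 <= f z t) ->
  lsc (fun p : Z * T => f p.1 p.2) ->
  lsc (fun t => ereal_inf (range (f^~ t))).
Proof.
move=> cZ f0 fl t u ut.
have H : \forall t' \near t, [set: Z] `<=` (fun z => u < f z t').
  apply: ((compact_near_coveringP _).1 cZ) => z _.
  apply: (fl (z, t)) => /=; apply: lt_le_trans ut _.
  by apply: ereal_inf_lbound; exists z.
have fz (t' : T) : lsc (f^~ t').
  apply: (@lsc_comp _ _ (fun z => (z, t')) _ _ fl) .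
  apply: continuous_pair => z; [exact: cvg_id|exact: cvg_cst].
near=> t'.
have Ht : [set: Z] `<=` (fun z => u < f z t') by near: t'.
have [->|[z ->]] := lsc_compact_inf cZ (f0^~ t') (fz t').
  exact: lt_le_trans ut (leey _).
exact: Ht.
Unshelve. all: by end_near. Qed.

(** Reduces the triangle inequalities of the amalgam to single points. The bound [0 <= y] excludes
    [-oo] when the infimum is [+oo]. *)
Lemma lee_addl_compact_inf (Z : topologicalType) (f : Z -> \bar R)
    (w y : \bar R) :
  compact [set: Z] -> (forall z, 0 <= f z) -> lsc f -> 0 <= y ->
  (forall z, w <= f z + y) -> w <= ereal_inf (range f) + y.
Proof.
move=> cZ f0 fl y0 H; have [->|[z ->]] := lsc_compact_inf cZ f0 fl.
  by rewrite addye ?leey // gt_eqF // (lt_le_trans _ y0) // ltNyr.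
exact: H.
Qed.

End LowerSemicontinuity.

(** * Quotients of compact Hausdorff spaces by metrics *)

Local Notation R := Rdefinitions.R.

Lemma compact_closed_map (X Y : topologicalType) (f : X -> Y) (F : set X) :
  continuous f -> compact [set: X] -> hausdorff_space Y -> closed F ->
  closed (f @` F).
Proof.
move=> fc cX hY cF; apply: compact_closed => //.
apply: continuous_compact; first exact: continuous_subspaceT.
exact: subclosed_compact cF cX _.
Qed.

(** Normality separates two disjoint closed fibres upstairs; complements of images of closed sets
    turn this into disjoint open neighbourhoods downstairs. *)
Lemma closed_map_hausdorff (X Y : topologicalType) (f : X -> Y) :
  continuous f -> (forall F, closed F -> closed (f @` F)) ->
  (forall y, exists x, f x = y) ->
  compact [set: X] -> hausdorff_space X -> hausdorff_space Y.
Proof.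
move=> fc fcl fs cX hX; rewrite open_hausdorff => p q pq.
have cfib y : closed (f @^-1` [set y]).
  apply: preimage_closed => [? _|]; first exact: fc.
  have [x <-] := fs y.
  rewrite -(image_set1 f x); apply: fcl.
  exact: accessible_closed_set1 (hausdorff_accessible hX) x.
have [|C AC CB] := @compact_normal X hX cX _ (cfib p) (~` (f @^-1` [set q])).
  apply/set_nbhsP; exists (~` (f @^-1` [set q])); split=> //.
    exact: closed_openC.
  by move=> x /= ->; exact/eqP.
have /set_nbhsP[U [oU AU UC]] := AC.
exists (~` (f @` (~` U)), ~` (f @` closure C))=> /=.
  split; rewrite inE; first by move=> -[x nUx fxp]; exact/nUx/AU.
  by move=> -[x /CB nq fxq]; exact: nq.
split=> //=.
- by apply: closed_openC; apply: fcl; exact: open_closedC.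
- by apply: closed_openC; apply: fcl; exact: closed_closure.
apply/eqP; apply/seteqP; split=> // y [] /= nU nC.
have [x fxy] := fs y; apply: nC; exists x => //; apply: subset_closure.
by apply: UC; apply: contrapT => nUx; apply: nU; exists x.
Qed.

Lemma hausdorff_prod (X Y : topologicalType) :
  hausdorff_space X -> hausdorff_space Y -> hausdorff_space (X * Y)%type.
Proof.
move=> hX hY [x y] [x' y'] cl; congr pair.
  apply: hX => U V Ux Vx'.
  have [] := cl (fst @^-1` U) (fst @^-1` V).
  - exact: (@cvg_fst _ _ _ _ _ _ Ux).
  - exact: (@cvg_fst _ _ _ _ _ _ Vx').
  by move=> [a b] /= [? ?]; exists a.
apply: hY => U V Uy Vy'.
have [] := cl (snd @^-1` U) (snd @^-1` V).
- exact: (@cvg_snd _ _ _ _ _ _ Uy).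
- exact: (@cvg_snd _ _ _ _ _ _ Vy').
by move=> [a b] /= [? ?]; exists b.
Qed.

Record quasimetric (T : Type) (g : T -> T -> \bar R) : Prop := Quasimetric {
  qm_ge0 : forall x y, 0 <= g x y;
  qm_refl : forall x, g x x = 0;
  qm_tri : forall x y z, g x z <= g x y + g y z }.

Lemma mdist_lsc (X : metCHsep) : lsc (fun p : X * X => mdist p.1 p.2).
Proof. by apply/lscP => [p|]; [exact: mdist_ge0|exact: mdist_cont]. Qed.

Lemma le0_mdist_eq (X : metCHsep) (x y : X) :
  mdist x y <= 0 -> mdist y x <= 0 -> x = y.
Proof.
by move=> xy yx; apply: mdist_sep; apply/eqP; rewrite eq_le mdist_ge0 andbT.
Qed.

Local Open Scope quotient_scope.

(** Being at distance 0 both ways is an equivalence relation, closed by lower semicontinuity. Over a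
    compact space this makes the quotient map closed, hence the quotient Hausdorff. *)
Lemma quasimetric_quotient (K : topologicalType) (g : K -> K -> \bar R) :
  quasimetric g -> compact [set: K] -> hausdorff_space K ->
  lsc (fun p : K * K => g p.1 p.2) ->
  exists (Q : metCHsep) (q : K -> Q), [/\ continuous q,
    forall y, exists x, q x = y & forall x y, mdist (q x) (q y) = g x y].
Proof.
move=> [g0 gr gt] cK hK gl.
pose e x y := (g x y <= 0) && (g y x <= 0).
have er : reflexive e by move=> x; rewrite /e gr lexx.
have es : symmetric e by move=> x y; rewrite /e andbC.
have et : transitive e.
  move=> y x z /andP[xy yx] /andP[yz zy]; apply/andP; split.
    by apply: le_trans (gt _ y _) _; rewrite -[0]adde0 leeD.
  by apply: le_trans (gt _ y _) _; rewrite -[0]adde0 leeD.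
pose E := EquivRel e er es et.
pose Q := quotient_topology {eq_quot E}.
pose q : K -> Q := \pi_Q.
have qP x y : q x = q y <-> e x y.
  by split=> [/eqmodP //|exy]; apply/eqmodP.
have qc : continuous q by exact: pi_continuous.
have qs y : exists x, q x = y by exists (repr y); exact: reprK.
have cE : closed [set p : K * K | e p.1 p.2].
  rewrite (_ : [set _ | _] = [set p : K * K | g p.1 p.2 <= 0] `&`
      [set p : K * K | g p.2 p.1 <= 0]); last first.
    by apply/seteqP; split=> p /=; [move/andP|move=> [? ?]; apply/andP].
  apply: closedI; first exact: lsc_closed gl.
  apply: lsc_closed.
  apply: (@lsc_comp _ _ _ (fun p : K * K => (p.2, p.1)) _ _ gl).
  by apply: continuous_pair => p; [exact: cvg_snd|exact: cvg_fst].
have cKK : compact [set: K * K] by rewrite -setXTT; exact: compact_setX.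
have qcl F : closed F -> closed (q @` F).
  move=> cF; rewrite -openC; change (open (q @^-1` (~` (q @` F)))).
  rewrite -preimage_setC openC.
  (* The saturation of [F] is a projection of a closed subset of [K * K]. *)
  rewrite (_ : _ @^-1` _ =
    snd @` ([set p : K * K | e p.1 p.2] `&` fst @^-1` F)).
    apply: compact_closed_map => //; first by move=> ?; exact: cvg_snd.
    apply: closedI => //; apply: preimage_closed => // ? _.
    exact: cvg_fst.
  apply/seteqP; split=> [x [z Fz /qP ezx]|_ [[z x] /= [ezx Fz] <-]].
    by exists (z, x).
  by exists z => //; apply/qP.
have hQ : hausdorff_space Q by exact: closed_map_hausdorff qc qcl qs cK hK.
have cQ : compact [set: Q].
  rewrite (_ : setT = q @` setT); last first.
    by apply/seteqP; split=> // y _; have [x <-] := qs y; exists x.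
  by apply: continuous_compact => //; exact: continuous_subspaceT.
(* By the triangle inequality [g] does not depend on the choice of representatives. *)
pose d (x y : Q) := g (repr x) (repr y).
have dq x y : d (q x) (q y) = g x y.
  have /qP/andP[x1 x2] : q (repr (q x)) = q x by exact: reprK.
  have /qP/andP[y1 y2] : q (repr (q y)) = q y by exact: reprK.
  apply/eqP; rewrite eq_le /d; apply/andP; split.
    apply: le_trans (gt _ x _) _; rewrite -[leRHS]add0e; apply: leeD => //.
    by apply: le_trans (gt _ y _) _; rewrite -[leRHS]adde0; apply: leeD.
  apply: le_trans (gt _ (repr (q x)) _) _.
  rewrite -[leRHS]add0e; apply: leeD => //.
  apply: le_trans (gt _ (repr (q y)) _) _.
  by rewrite -[leRHS]adde0; apply: leeD.
(* Sublevel sets of [d] are images of sublevel sets of [g], hence closed. *)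
have dl (u : \bar R) : 0 <= u -> open [set p : Q * Q | u < d p.1 p.2].
  move=> u0; pose h (p : K * K) : Q * Q := (q p.1, q p.2).
  rewrite (_ : [set _ | _] = ~` (h @` [set p | g p.1 p.2 <= u])).
    apply: closed_openC; apply: compact_closed_map => //.
    - exact: continuous_prod_map.
    - exact: hausdorff_prod.
    - exact: lsc_closed gl.
  apply/seteqP; split=> [[x' y'] /= ud [[x y] /= gu [xe ye]]|[x' y'] /=].
    by move: ud; rewrite -xe -ye dq ltNge gu.
  have [x <-] := qs x'; have [y <-] := qs y' => nh.
  by rewrite dq ltNge; apply/negP => gu; apply: nh; exists (x, y).
have dsep x y : d x y = 0 -> d y x = 0 -> x = y.
  have [x' <-] := qs x; have [y' <-] := qs y; rewrite !dq => xy yx.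
  by apply/qP; rewrite /e xy yx lexx.
exists (@MetCHsep Q d (fun x y => g0 _ _) (fun x => gr _)
  (fun x y z => gt _ _ _) dsep cQ hQ dl), q.
by split.
Qed.

(** * Topology of subspaces and binary sums *)

Lemma injective_hausdorff (X Y : topologicalType) (f : X -> Y) :
  continuous f -> injective f -> hausdorff_space Y -> hausdorff_space X.
Proof.
move=> fc fi hY x y cl; apply/fi/hY => U V Ux Vy.
have [z [Uz Vz]] := cl _ _ (fc x _ Ux) (fc y _ Vy).
by exists (f z).
Qed.

Lemma set_type_compact (X : topologicalType) (S : set X) :
  compact S -> compact [set: set_type S].
Proof.
move=> cS F PF _.
have [x [Sx clx]] : exists x, S x /\ cluster (set_val @ F) x.
  have [|x [Sx clx]] := cS (set_val @ F) _; last by exists x.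
  by apply: (@filterS _ F _ setT _ _ filterT) => z _; exact: set_valP.
exists (SigSub (mem_set Sx)); split=> // P U FP.
case=> _ [[V oV <-] /= Vx VU].
have nV : nbhs x V by exact: open_nbhs_nbhs.
have [|y [[z Pz <-] Vy]] := clx (set_val @` P) V _ nV.
  by apply: (@filterS _ F _ P _ _ FP) => z Pz; exists z.
by exists z; split=> //; exact: VU.
Qed.

Lemma lsc_sigT (I : choiceType) (X : I -> topologicalType)
    (h : {i & X i} * {i & X i} -> \bar R) :
  (forall i j, lsc (fun p : X i * X j => h (existT _ i p.1, existT _ j p.2))) ->
  lsc h.
Proof.
move=> H [[i x] [j y]] u hu.
have [/= [P Q] [/= nP nQ] PQ] := H i j (x, y) u hu.
exists (existT X i @` P, existT X j @` Q) => /=.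
  by split; exact: existT_nbhs.
by move=> [_ _] /= [[a Pa <-] [b Qb <-]]; exact: (PQ (a, b)).
Qed.

Definition copair (B C T : Type) (j1 : B -> T) (j2 : C -> T) (x : B + C) : T :=
  match x with inl b => j1 b | inr c => j2 c end.

Definition jointly_surjective (B C T : Type) (j1 : B -> T) (j2 : C -> T) :=
  forall z, exists x, copair j1 j2 x = z.

(** The sum is modelled by a sigma type over [bool], so semicontinuity is checked on four blocks;
    domination by [mdist] on each summand makes [j1] and [j2] non-expansive. *)
Lemma sum_quotient (B C : metCHsep) (g : B + C -> B + C -> \bar R) :
  quasimetric g ->
  (forall b b', g (inl b) (inl b') <= mdist b b') ->
  (forall c c', g (inr c) (inr c') <= mdist c c') ->
  lsc (fun p : B * B => g (inl p.1) (inl p.2)) ->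
  lsc (fun p : B * C => g (inl p.1) (inr p.2)) ->
  lsc (fun p : C * B => g (inr p.1) (inl p.2)) ->
  lsc (fun p : C * C => g (inr p.1) (inr p.2)) ->
  exists (Q : metCHsep) (j1 : mhom B Q) (j2 : mhom C Q),
    jointly_surjective j1 j2 /\
    forall x y, mdist (copair j1 j2 x) (copair j1 j2 y) = g x y.
Proof.
move=> [g0 gr gt] gB gC lBB lBC lCB lCC.
pose X (i : bool) : topologicalType := if i then mcar B else mcar C.
pose phi (p : {i & X i}) : B + C :=
  match p with existT i x =>
    (if i return X i -> B + C then inl else inr) x end.
pose psi (x : B + C) : {i & X i} :=
  match x with inl b => existT X true b | inr c => existT X false c end.
have psiK x : phi (psi x) = x by case: x.
have phiK p : psi (phi p) = p by case: p => -[].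
have [| | | |Q [q [qc qs dq]]] :=
  @quasimetric_quotient {i & X i} (fun x y => g (phi x) (phi y)).
- by split=> *; [exact: g0|exact: gr|exact: gt].
- by apply: sigT_compact => [|[]]; [exact: finite_finset|exact: mcompact..].
- by apply: sigT_hausdorff => -[]; exact: mhausdorff.
- by apply: lsc_sigT => -[] [].
have c1 : continuous (fun b : B => q (existT X true b)).
  move=> b; apply: (@continuous_comp _ _ _ (existT X true) q); last exact: qc.
  exact: existT_continuous.
have c2 : continuous (fun c : C => q (existT X false c)).
  move=> c; apply: (@continuous_comp _ _ _ (existT X false) q); last exact: qc.
  exact: existT_continuous.
have n1 b b' : mdist (q (existT X true b)) (q (existT X true b')) <= mdist b b'.
  by rewrite dq; exact: gB.
have n2 c c' :
    mdist (q (existT X false c)) (q (existT X false c')) <= mdist c c'.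
  by rewrite dq; exact: gC.
have qE x : copair (MHom c1 n1) (MHom c2 n2) x = q (psi x) by case: x.
exists Q, (MHom c1 n1), (MHom c2 n2); split.
  by move=> z; have [x <-] := qs z; exists (phi x); rewrite qE phiK.
by move=> x y; rewrite !qE dq !psiK.
Qed.

(** * Morphisms: isometric embeddings, lifting and gluing *)

Lemma mhomP (X Y : metCHsep) (f g : mhom X Y) : (forall x, f x = g x) -> f = g.
Proof. by move=> fg; apply/mhom_eq/funext. Qed.

Lemma mhom_compE (X Y Y' Z : metCHsep) (f : mhom X Y) (g : mhom Y Z)
    (f' : mhom X Y') (g' : mhom Y' Z) :
  mhom_comp g f = mhom_comp g' f' -> forall x, g (f x) = g' (f' x).
Proof. by move=> E x; exact: (congr1 (fun h : mhom X Z => h x) E). Qed.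

Lemma mhom_closed_map (X Y : metCHsep) (f : mhom X Y) (F : set X) :
  closed F -> closed (f @` F).
Proof.
apply: compact_closed_map;
  [exact: mfun_cont|exact: mcompact|exact: mhausdorff].
Qed.

Lemma mhom_closed_preimage (X Y : metCHsep) (f : mhom X Y) (F : set Y) :
  closed F -> closed (f @^-1` F).
Proof. by apply: preimage_closed => ? _; exact: mfun_cont. Qed.

Definition isometric (X Y : metCHsep) (f : mhom X Y) :=
  forall x y, mdist (f x) (f y) = mdist x y.

Lemma isometric_inj (X Y : metCHsep) (f : mhom X Y) :
  isometric f -> injective f.
Proof.
move=> fi x y fxy; apply: le0_mdist_eq; rewrite -fi fxy mdist_refl lexx //.
Qed.

Lemma isometric_lift (A B D : metCHsep) (e : mhom A B) (h : mhom D B) :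
  isometric e -> (forall z, exists a, e a = h z) ->
  exists u : mhom D A, mhom_comp e u = h.
Proof.
move=> ei /choice[u eu].
have uc : continuous u.
  apply/continuous_closedP => F cF.
  rewrite (_ : u @^-1` F = h @^-1` (e @` F)).
    by apply: mhom_closed_preimage; apply: mhom_closed_map.
  apply/seteqP; split=> [z Fuz|z [a Fa]] /=; first by exists (u z).
  by rewrite -eu => /(isometric_inj ei) <-.
have un x y : mdist (u x) (u y) <= mdist x y.
  by rewrite -ei !eu; exact: mfun_nonexp.
by exists (MHom uc un); apply: mhomP.
Qed.

Lemma jointly_surjective_epi (B C Q D : metCHsep)
    (j1 : mhom B Q) (j2 : mhom C Q) (u v : mhom Q D) :
  jointly_surjective j1 j2 -> mhom_comp u j1 = mhom_comp v j1 ->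
  mhom_comp u j2 = mhom_comp v j2 -> u = v.
Proof.
move=> js /mhom_compE E1 /mhom_compE E2; apply: mhomP => z.
by have [[b|c] <-] := js z; [exact: E1|exact: E2].
Qed.

(** By separation, the inequality makes [copair h k] identify whatever [copair j1 j2] identifies.
    The preimage of a closed set is a union of images of closed sets under [j1] and [j2], whence
    continuity. *)
Lemma mhom_glue (B C Q D : metCHsep)
    (j1 : mhom B Q) (j2 : mhom C Q) (h : mhom B D) (k : mhom C D) :
  jointly_surjective j1 j2 ->
  (forall x y, mdist (copair h k x) (copair h k y) <=
               mdist (copair j1 j2 x) (copair j1 j2 y)) ->
  exists u : mhom Q D, mhom_comp u j1 = h /\ mhom_comp u j2 = k.
Proof.
move=> js hk; have /choice[s sE] := js.
have uE x : copair h k (s (copair j1 j2 x)) = copair h k x.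
  by apply: le0_mdist_eq; apply: le_trans (hk _ _) _; rewrite sE mdist_refl.
have uc : continuous (copair h k \o s).
  apply/continuous_closedP => F cF.
  rewrite (_ : _ @^-1` F = (j1 @` (h @^-1` F)) `|` (j2 @` (k @^-1` F))).
    by apply: closedU; apply: mhom_closed_map; apply: mhom_closed_preimage.
  apply/seteqP; split=> [z /= Fz|z [[b Fb <-]|[c Fc <-]] /=].
  - case sz : (s z) Fz (sE z) => [b|c] /= Fz <-; first by left; exists b.
    by right; exists c.
  - by rewrite (uE (inl b)).
  - by rewrite (uE (inr c)).
have un x y : mdist ((copair h k \o s) x) ((copair h k \o s) y) <= mdist x y.
  by apply: le_trans (hk _ _) _; rewrite !sE.
exists (MHom uc un); split; apply: mhomP => x /=.
  exact: (uE (inl x)).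
exact: (uE (inr x)).
Qed.

Lemma closed_subobject (X : metCHsep) (S : set X) : closed S ->
  exists (E : metCHsep) (i : mhom E X), isometric i /\ range i = S.
Proof.
move=> cS.
have ic : continuous (set_val : set_type S -> X) by exact: initial_continuous.
have cE : compact [set: set_type S].
  exact/set_type_compact/(subclosed_compact cS (@mcompact X)).
have hE : hausdorff_space (set_type S).
  apply: (injective_hausdorff ic); [exact: val_inj|exact: mhausdorff].
have dl (u : \bar R) : 0 <= u ->
    open [set p : set_type S * set_type S | u < mdist (val p.1) (val p.2)].
  apply: (lscP (f := fun p => _) _).1 => [p|]; first exact: mdist_ge0.
  apply: (@lsc_comp _ _ _
    (fun p : set_type S * set_type S => (val p.1, val p.2)) _ _ (@mdist_lsc X)).
  exact: continuous_prod_map.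
pose E := @MetCHsep (set_type S) (fun x y => mdist (val x) (val y))
  (fun x y => mdist_ge0 _ _) (fun x => mdist_refl _)
  (fun x y z => mdist_tri _ _ _)
  (fun x y xy yx => val_inj (mdist_sep xy yx)) cE hE dl.
exists E, (@MHom E X set_val ic (fun x y => lexx _)); split=> //=.
apply/seteqP; split=> [_ [x _ <-]|x Sx]; first exact: set_valP.
by exists (SigSub (mem_set Sx)).
Qed.

(** * Amalgamation along an isometric embedding *)

Lemma lsc_mdist (K : topologicalType) (X : metCHsep) (f g : K -> X) :
  continuous f -> continuous g -> lsc (fun k => mdist (f k) (g k)).
Proof.
move=> fc gc.
exact: (@lsc_comp _ _ _ (fun k => (f k, g k)) _ (continuous_pair fc gc)
  (@mdist_lsc X)).
Qed.

Section Amalgam.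
Variables (A B C : metCHsep) (e : mhom A B) (g : mhom A C).
Hypothesis ei : isometric e.

(* alpha and beta are the distances between B and C that pass through A, and
   sigma is the distance between points of B that passes through C. *)
Let alpha (b : B) (c : C) : \bar R :=
  ereal_inf (range (fun a => mdist b (e a) + mdist (g a) c)).
Let beta (c : C) (b : B) : \bar R :=
  ereal_inf (range (fun a => mdist c (g a) + mdist (e a) b)).
Let sigma (b b' : B) : \bar R :=
  ereal_inf (range (fun c => alpha b c + beta c b')).

Let alpha_ge0 b c : 0 <= alpha b c.
Proof.
by apply: le_ereal_inf_tmp => _ [a _ <-]; rewrite adde_ge0 ?mdist_ge0.
Qed.
Let beta_ge0 c b : 0 <= beta c b.
Proof.
by apply: le_ereal_inf_tmp => _ [a _ <-]; rewrite adde_ge0 ?mdist_ge0.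
Qed.
Let sigma_ge0 b b' : 0 <= sigma b b'.
Proof. by apply: le_ereal_inf_tmp => _ [a _ <-]; rewrite adde_ge0. Qed.

Let alpha_lsc : lsc (fun p : B * C => alpha p.1 p.2).
Proof.
apply: (@lsc_inf _ A _ (fun a p => mdist p.1 (e a) + mdist (g a) p.2)).
- exact: mcompact.
- by move=> a p; rewrite adde_ge0 ?mdist_ge0.
have c1 : continuous (fun q : A * (B * C) => q.1) by exact: continuous_fst.
have c2 : continuous (fun q : A * (B * C) => q.2) by exact: continuous_snd.
apply: lsc_add => [q|q||]; [exact: mdist_ge0|exact: mdist_ge0|..];
  apply: lsc_mdist.
- exact: continuous_compT c2 (@continuous_fst _ _).
- exact: continuous_compT c1 (@mfun_cont _ _ e).
- exact: continuous_compT c1 (@mfun_cont _ _ g).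
- exact: continuous_compT c2 (@continuous_snd _ _).
Qed.

Let beta_lsc : lsc (fun p : C * B => beta p.1 p.2).
Proof.
apply: (@lsc_inf _ A _ (fun a p => mdist p.1 (g a) + mdist (e a) p.2)).
- exact: mcompact.
- by move=> a p; rewrite adde_ge0 ?mdist_ge0.
have c1 : continuous (fun q : A * (C * B) => q.1) by exact: continuous_fst.
have c2 : continuous (fun q : A * (C * B) => q.2) by exact: continuous_snd.
apply: lsc_add => [q|q||]; [exact: mdist_ge0|exact: mdist_ge0|..];
  apply: lsc_mdist.
- exact: continuous_compT c2 (@continuous_fst _ _).
- exact: continuous_compT c1 (@mfun_cont _ _ g).
- exact: continuous_compT c1 (@mfun_cont _ _ e).
- exact: continuous_compT c2 (@continuous_snd _ _).
Qed.

Let alpha_beta_lsc :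
  lsc (fun q : C * (B * B) => alpha q.2.1 q.1 + beta q.1 q.2.2).
Proof.
have c1 : continuous (fun q : C * (B * B) => q.1) by exact: continuous_fst.
have c2 : continuous (fun q : C * (B * B) => q.2) by exact: continuous_snd.
apply: lsc_add => [q|q||]; [exact: alpha_ge0|exact: beta_ge0|..].
- apply: (@lsc_comp _ _ _ (fun q : C * (B * B) => (q.2.1, q.1)) _ _ alpha_lsc).
  apply: continuous_pair => //.
  exact: continuous_compT c2 (@continuous_fst _ _).
- apply: (@lsc_comp _ _ _ (fun q : C * (B * B) => (q.1, q.2.2)) _ _ beta_lsc).
  apply: continuous_pair => //.
  exact: continuous_compT c2 (@continuous_snd _ _).
Qed.

Let sigma_lsc : lsc (fun p : B * B => sigma p.1 p.2).
Proof.
apply: (@lsc_inf _ C _ (fun c p => alpha p.1 c + beta c p.2)) => //.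
- exact: mcompact.
- by move=> c p; rewrite adde_ge0.
Qed.

Let alpha_le b c a : alpha b c <= mdist b (e a) + mdist (g a) c.
Proof. by apply: ereal_inf_lbound; exists a. Qed.
Let beta_le b c a : beta c b <= mdist c (g a) + mdist (e a) b.
Proof. by apply: ereal_inf_lbound; exists a. Qed.
Let sigma_le b b' c : sigma b b' <= alpha b c + beta c b'.
Proof. by apply: ereal_inf_lbound; exists c. Qed.

Let alpha_sect_lsc b c : lsc (fun a => mdist b (e a) + mdist (g a) c).
Proof.
by apply: lsc_add => [a|a||]; rewrite ?mdist_ge0 //; apply: lsc_mdist;
  (exact: mfun_cont || (move=> ?; exact: cvg_cst)).
Qed.

Let beta_sect_lsc b c : lsc (fun a => mdist c (g a) + mdist (e a) b).
Proof.
by apply: lsc_add => [a|a||]; rewrite ?mdist_ge0 //; apply: lsc_mdist;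
  (exact: mfun_cont || (move=> ?; exact: cvg_cst)).
Qed.

Let sigma_sect_lsc b b' : lsc (fun c => alpha b c + beta c b').
Proof.
apply: (@lsc_comp _ _ _ (fun c => (c, (b, b'))) _ _ alpha_beta_lsc).
by apply: continuous_pair => ?; [exact: cvg_id|exact: cvg_cst].
Qed.

Let le_alphal b c w y : 0 <= y ->
  (forall a, w <= mdist b (e a) + mdist (g a) c + y) -> w <= alpha b c + y.
Proof.
apply: lee_addl_compact_inf => // [|a]; first exact: mcompact.
by rewrite adde_ge0 ?mdist_ge0.
Qed.

Let le_betal b c w y : 0 <= y ->
  (forall a, w <= mdist c (g a) + mdist (e a) b + y) -> w <= beta c b + y.
Proof.
apply: lee_addl_compact_inf => // [|a]; first exact: mcompact.
by rewrite adde_ge0 ?mdist_ge0.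
Qed.

Let le_sigmal b b' w y : 0 <= y ->
  (forall c, w <= alpha b c + beta c b' + y) -> w <= sigma b b' + y.
Proof.
apply: lee_addl_compact_inf => // [|a]; first exact: mcompact.
by rewrite adde_ge0.
Qed.

(* tri_p_qr proves p <= q + r, where d, a, b, s stand for mdist, alpha, beta,
   sigma. *)
Let tri_d_ba c b c' : mdist c c' <= beta c b + alpha b c'.
Proof.
apply: le_betal => // a; rewrite addeC.
apply: le_alphal => [|a']; first by rewrite adde_ge0 ?mdist_ge0.
rewrite addeC; apply: le_trans (mdist_tri _ (g a) _) _.
rewrite -addeA leeD2l //; apply: le_trans (mdist_tri _ (g a') _) _.
(* Here the isometry enters: [d(g a, g a') <= d(a, a') = d(e a, e a')], which is at most the length
   of the detour through [b]. *)
rewrite addeA leeD2r //; apply: le_trans (mfun_nonexp g _ _) _.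
by rewrite -ei mdist_tri.
Qed.

Let tri_b_db c c' b : beta c b <= mdist c c' + beta c' b.
Proof.
rewrite addeC; apply: le_betal => [|a]; first exact: mdist_ge0.
apply: le_trans (beta_le _ _ a) _.
by rewrite [leRHS]addeC addeA leeD2r // mdist_tri.
Qed.

Let tri_a_ad b c c' : alpha b c' <= alpha b c + mdist c c'.
Proof.
apply: le_alphal => [|a]; first exact: mdist_ge0.
apply: le_trans (alpha_le _ _ a) _.
by rewrite -addeA leeD2l // mdist_tri.
Qed.

Let tri_a_da b b' c : alpha b c <= mdist b b' + alpha b' c.
Proof.
rewrite addeC; apply: le_alphal => [|a]; first exact: mdist_ge0.
apply: le_trans (alpha_le _ _ a) _.
by rewrite [leRHS]addeC addeA leeD2r // mdist_tri.
Qed.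

Let tri_b_bd c b b' : beta c b' <= beta c b + mdist b b'.
Proof.
apply: le_betal => [|a]; first exact: mdist_ge0.
apply: le_trans (beta_le _ _ a) _.
by rewrite -addeA leeD2l // mdist_tri.
Qed.

Let tri_s_ds b b' b'' : sigma b b'' <= mdist b b' + sigma b' b''.
Proof.
rewrite addeC; apply: le_sigmal => [|c]; first exact: mdist_ge0.
apply: le_trans (sigma_le _ _ c) _.
by rewrite [leRHS]addeC addeA leeD2r.
Qed.

Let tri_s_sd b b' b'' : sigma b b'' <= sigma b b' + mdist b' b''.
Proof.
apply: le_sigmal => [|c]; first exact: mdist_ge0.
by apply: le_trans (sigma_le _ _ c) _; rewrite -addeA leeD2l.
Qed.

Let tri_a_sa b b' c : alpha b c <= sigma b b' + alpha b' c.
Proof.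
apply: le_sigmal => // c'; apply: le_trans (tri_a_ad _ c' _) _.
by rewrite -addeA leeD2l.
Qed.

Let tri_b_bs b b' c : beta c b' <= beta c b + sigma b b'.
Proof.
rewrite addeC; apply: le_sigmal => // c'; apply: le_trans (tri_b_db _ c' _) _.
by rewrite [leRHS]addeC addeA leeD2r.
Qed.

Let tri_s_ss b b' b'' : sigma b b'' <= sigma b b' + sigma b' b''.
Proof.
apply: le_sigmal => // c; apply: le_trans (sigma_le _ _ c) _.
by rewrite -addeA leeD2l.
Qed.

(** The shortest-path metric on the glued space. A path between points of [B] may gain from crossing
    [C], as [g] can shrink distances; between points of [C] a detour through [B] never helps, by
    [tri_d_ba]. *)
Let gamma (x y : B + C) : \bar R :=
  match x, y with
  | inl b, inl b' => Order.min (mdist b b') (sigma b b')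
  | inl b, inr c => alpha b c
  | inr c, inl b => beta c b
  | inr c, inr c' => mdist c c'
  end.

Let gamma_quasimetric : quasimetric gamma.
Proof.
split.
- by move=> [b|c] [b'|c'] //=; rewrite ?le_min ?mdist_ge0 //= sigma_ge0.
- move=> [b|c] /=; last exact: mdist_refl.
  by rewrite mdist_refl; apply/min_idPl.
move=> [b|c] [b'|c'] [b''|c''] //=; rewrite ?mdist_tri //.
- have sle x : sigma b b'' <= x ->
    Order.min (mdist b b'') (sigma b b'') <= x.
    by move=> sx; rewrite ge_min sx orbT.
  (* Of the four sums selected by the two minima, the three with a [sigma] summand bound
     [sigma b b'']; the fourth is the triangle inequality in [B]. *)
  rewrite {2 3}/Order.min; case: ifP => _; case: ifP => _; try exact: sle.
  by rewrite ge_min mdist_tri.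
- by rewrite /Order.min; case: ifP.
- by rewrite ge_min sigma_le orbT.
- by rewrite /Order.min; case: ifP.
Qed.

(** Attained cross distances let points of [A] be read off from distances in [Q]; the alternative
    [+oo] accounts for an empty [A]. *)
Lemma isometric_amalgam :
  exists (Q : metCHsep) (j1 : mhom B Q) (j2 : mhom C Q),
    [/\ mhom_comp j1 e = mhom_comp j2 g, isometric j2 &
      forall b c, mdist (j1 b) (j2 c) = +oo \/
        exists a, mdist (j1 b) (j2 c) = mdist b (e a) + mdist (g a) c].
Proof.
have [||||||Q [j1 [j2 [js dj]]]] := @sum_quotient B C gamma gamma_quasimetric.
- by move=> b b' /=; rewrite ge_min lexx.
- by [].
- by apply: lsc_min; [exact: mdist_lsc|exact: sigma_lsc].
- exact: alpha_lsc.
- exact: beta_lsc.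
- exact: mdist_lsc.
exists Q, j1, j2; split.
- apply: mhomP => a /=; apply: le0_mdist_eq.
    rewrite (dj (inl _) (inr _)) /=; apply: le_trans (alpha_le _ _ a) _.
    by rewrite !mdist_refl adde0.
  rewrite (dj (inr _) (inl _)) /=; apply: le_trans (beta_le _ _ a) _.
  by rewrite !mdist_refl adde0.
- by move=> c c'; rewrite (dj (inr _) (inr _)).
- move=> b c; rewrite (dj (inl _) (inr _)) /=.
  apply: lsc_compact_inf; [exact: mcompact| |exact: alpha_sect_lsc].
  by move=> a; rewrite adde_ge0 ?mdist_ge0.
Qed.

End Amalgam.

(** * Equalisers and pushouts *)

(** Amalgamate [B] with itself along [e]: if [j1 b = j2 b], the attained distance 0 gives some [a]
    with [d(b, e a) = d(e a, b) = 0], and separation applies. *)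
Lemma isometric_coincidence (A B : metCHsep) (e : mhom A B) : isometric e ->
  exists (Q : metCHsep) (j1 j2 : mhom B Q), mhom_comp j1 e = mhom_comp j2 e /\
    forall b, j1 b = j2 b -> exists a, e a = b.
Proof.
move=> ei; have [Q [j1 [j2 [jE _ jd]]]] := isometric_amalgam e ei.
exists Q, j1, j2; split=> // b jb; have := jd b b.
rewrite jb mdist_refl => -[//|[a /esym/eqP]].
rewrite padde_eq0 ?mdist_ge0 // => /andP[/eqP ba /eqP ab].
by exists a; exact: mdist_sep.
Qed.

Lemma mhom_equaliser_closed (X Y : metCHsep) (f g : mhom X Y) :
  closed [set x | f x = g x].
Proof.
rewrite (_ : [set _ | _] =
  [set x | mdist (f x) (g x) <= 0] `&` [set x | mdist (g x) (f x) <= 0]).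
  by apply: closedI; apply: lsc_closed; apply: lsc_mdist; exact: mfun_cont.
apply/seteqP; split=> [x /= ->|x /= [? ?]]; first by rewrite mdist_refl.
exact: le0_mdist_eq.
Qed.

(** The union of the two ranges is closed, so it is the image of an isometric embedding. The pair
    that [isometric_coincidence] attaches to it agrees on both ranges, hence is equal, and then
    every point lies in the union. *)
Lemma jointly_epi_surjective (X X' Y : metCHsep)
    (r1 : mhom X Y) (r2 : mhom X' Y) :
  (forall (Z : metCHsep) (u v : mhom Y Z), mhom_comp u r1 = mhom_comp v r1 ->
     mhom_comp u r2 = mhom_comp v r2 -> u = v) ->
  jointly_surjective r1 r2.
Proof.
move=> epi.
have cS : closed (range r1 `|` range r2).
  by apply: closedU; apply: mhom_closed_map; exact: closedT.
have [E [i [ii iS]]] := closed_subobject cS.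
have [Q [j1 [j2 [/mhom_compE jE jS]]]] := isometric_coincidence ii.
have jS' z : (range r1 `|` range r2) z -> j1 z = j2 z.
  by rewrite -iS => -[a _ <-]; exact: jE.
have j12 : j1 = j2.
  by apply: epi; apply: mhomP => x /=; apply: jS'; [left|right]; exists x.
move=> z; have [|a iaz] := jS z; first by rewrite j12.
have : (range r1 `|` range r2) z by rewrite -iS; exists a.
by move=> [[x _ xz]|[x _ xz]]; [exists (inl x)|exists (inr x)].
Qed.

Lemma equaliser_exists (X Y : metCHsep) (f g : mhom X Y) :
  exists (E : metCHsep) (i : mhom E X),
    [/\ isometric i, mhom_comp f i = mhom_comp g i &
      forall (D : metCHsep) (h : mhom D X), mhom_comp f h = mhom_comp g h ->
        exists u : mhom D E, mhom_comp i u = h].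
Proof.
have [E [i [ii iS]]] := closed_subobject (@mhom_equaliser_closed _ _ f g).
have iE x : f x = g x -> exists a, i a = x.
  by move=> fgx; have : range i x by [rewrite iS]; case=> a _ <-; exists a.
exists E, i; split=> // [|D h /mhom_compE fh].
  by apply: mhomP => a /=; have : range i (i a) by [exists a]; rewrite iS.
by apply: isometric_lift => // z; exact: iE.
Qed.

Lemma isometric_monic (A B D : metCHsep) (e : mhom A B) (u v : mhom D A) :
  isometric e -> mhom_comp e u = mhom_comp e v -> u = v.
Proof.
move=> ei /mhom_compE E; apply: mhomP => z; exact/(isometric_inj ei)/E.
Qed.

Lemma pushout_exists (A B C : metCHsep) (f : mhom A B) (h : mhom A C) :
  exists (P : metCHsep) (p1 : mhom B P) (p2 : mhom C P),
    [/\ jointly_surjective p1 p2, mhom_comp p1 f = mhom_comp p2 h &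
      forall (D : metCHsep) (u : mhom B D) (v : mhom C D),
        mhom_comp u f = mhom_comp v h ->
        forall x y, mdist (copair u v x) (copair u v y) <=
                    mdist (copair p1 p2 x) (copair p1 p2 y)].
Proof.
(* The pushout carries the supremum of the metrics that cocones induce on
   B + C; the constant metric 0 is one of them. *)
pose Phi := [set g : (B + C) * (B + C) -> \bar R |
  exists (D : metCHsep) (u : mhom B D) (v : mhom C D),
    mhom_comp u f = mhom_comp v h /\
    g = fun p => mdist (copair u v p.1) (copair u v p.2)].
pose s x y := ereal_sup [set g (x, y) | g in Phi].
have Phi_ge0 g p : Phi g -> 0 <= g p.
  by move=> [D [u [v [_ ->]]]]; exact: mdist_ge0.
(* A member of [Phi] keeps the supremum [s] nonnegative rather than [-oo]. *)
have [g0 Phig0] : Phi !=set0.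
  have [|||||||D [u [v [_ d0]]]] := @sum_quotient B C (fun _ _ => 0).
  - by split=> // *; rewrite adde0.
  - exact: mdist_ge0.
  - exact: mdist_ge0.
  - exact: lsc_cst.
  - exact: lsc_cst.
  - exact: lsc_cst.
  - exact: lsc_cst.
  exists (fun p => mdist (copair u v p.1) (copair u v p.2)), D, u, v.
  split=> //.
  apply: mhomP => a /=; apply: le0_mdist_eq.
    by rewrite (d0 (inl _) (inr _)).
  by rewrite (d0 (inr _) (inl _)).
have s_ub x y g : Phi g -> g (x, y) <= s x y.
  by move=> Pg; apply: ereal_sup_ubound; exists g.
have s_qm : quasimetric s.
  split=> [x y|x|x y z].
  - by apply: le_trans (s_ub _ _ _ Phig0); exact: Phi_ge0.
  - apply/eqP; rewrite eq_le; apply/andP; split.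
      apply: ge_ereal_sup => _ [_ [D [u [v [_ ->]]]] <-].
      by rewrite /= mdist_refl.
    by apply: le_trans (s_ub _ _ _ Phig0); exact: Phi_ge0.
  - apply: ge_ereal_sup => _ [g Pg <-].
    apply: (@le_trans _ _ (g (x, y) + g (y, z))); last by rewrite leeD ?s_ub.
    by case: Pg => [D [u [v [_ ->]]]]; exact: mdist_tri.
(* With [a] and [b] standing for either injection, one claim serves all four blocks. *)
have s_lsc (X Y : topologicalType) (a : X -> B + C) (b : Y -> B + C) :
    (forall (D : metCHsep) (u : mhom B D) (v : mhom C D),
      continuous (copair u v \o a)) ->
    (forall (D : metCHsep) (u : mhom B D) (v : mhom C D),
      continuous (copair u v \o b)) ->
    lsc (fun p : X * Y => s (a p.1) (b p.2)).
  move=> ac bc.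
  have := @lsc_sup _ (X * Y)%type
    [set (fun p => g (a p.1, b p.2)) | g in Phi].
  rewrite (_ : (fun x => ereal_sup _) = (fun p => s (a p.1) (b p.2))).
    apply => _ [_ [D [u [v [_ ->]]]] <-] /=.
    apply: lsc_mdist.
      exact: continuous_compT (@continuous_fst _ _) (ac D u v).
    exact: continuous_compT (@continuous_snd _ _) (bc D u v).
  apply/funext => p; congr ereal_sup; apply/seteqP.
  split=> [_ [_ [g Pg <-] <-]|_ [g Pg <-]]; first by exists g.
  by exists (fun p => g (a p.1, b p.2)) => //; exists g.
have inlc (D : metCHsep) (u : mhom B D) (v : mhom C D) :
  continuous (copair u v \o inl) by exact: (@mfun_cont _ _ u).
have inrc (D : metCHsep) (u : mhom B D) (v : mhom C D) :
  continuous (copair u v \o inr) by exact: (@mfun_cont _ _ v).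
have [||||||P [p1 [p2 [ps dp]]]] := @sum_quotient B C s s_qm.
- move=> b b'; apply: ge_ereal_sup => _ [_ [D [u [v [_ ->]]]] <-].
  exact: mfun_nonexp.
- move=> c c'; apply: ge_ereal_sup => _ [_ [D [u [v [_ ->]]]] <-].
  exact: mfun_nonexp.
- exact: s_lsc.
- exact: s_lsc.
- exact: s_lsc.
- exact: s_lsc.
exists P, p1, p2; split=> // [|D u v uv x y].
  apply: mhomP => a /=; apply: le0_mdist_eq.
    rewrite (dp (inl _) (inr _)).
    apply: ge_ereal_sup => _ [_ [D [u [v [/mhom_compE uv ->]]]] <-] /=.
    by rewrite uv mdist_refl.
  rewrite (dp (inr _) (inl _)).
  apply: ge_ereal_sup => _ [_ [D [u [v [/mhom_compE uv ->]]]] <-] /=.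
  by rewrite uv mdist_refl.
rewrite dp.
apply: (s_ub x y (fun p => mdist (copair u v p.1) (copair u v p.2))).
by exists D, u, v.
Qed.

(** The empty space is initial, hence terminal in the opposite category. *)
Lemma empty_object_exists : exists X : metCHsep, X -> False.
Proof.
pose T : topologicalType := set_type (@set0 nat).
have T0 (x : T) : False by case: x => x; rewrite in_set0.
have cT : compact [set: T].
  move=> F PF _; have [x _] := filter_ex (@filterT _ F _); case: (T0 x).
have oT (u : \bar R) : 0 <= u -> open [set p : T * T | u < 0].
  by rewrite openE => _ [x ?]; case: (T0 x).
by exists (@MetCHsep T (fun _ _ => 0) (fun _ _ => lexx _) (fun _ => erefl)
  (fun x _ _ => False_ind _ (T0 x)) (fun x _ _ _ => False_ind _ (T0 x))
  cT (fun x _ _ => False_ind _ (T0 x)) oT).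
Qed.

(** * Effectiveness of coequivalence relations *)

Section Interpolation.
Variables (X : metCHsep) (rho : X -> X -> \bar R).
Hypothesis rho_ge0 : forall x y, 0 <= rho x y.
Hypothesis rho_tri : forall x y z, rho x z <= rho x y + rho y z.
Hypothesis rho_lsc : lsc (fun p : X * X => rho p.1 p.2).
Hypothesis rho_interp : forall x y,
  rho x y = +oo \/ exists z, rho x z + rho z y <= rho x y.

(** Each interpolation towards [y] lowers [a n = rho (z n) y] by at least [rho (z n) (z n.+1)],
    which makes [z] Cauchy; semicontinuity carries the resulting inequalities to a cluster point
    [w]. *)
Lemma self_zero_interpolation (x y : X) :
  rho x y = +oo \/ exists z, rho z z <= 0 /\ rho x z + rho z y <= rho x y.
Proof.
have [|xy] := eqVneq (rho x y) +oo; [by left|right].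
(* Where [rho w y] is infinite the choice defaults to [w]; [afin] shows that this never occurs along
   the iteration. *)
have /choice[s sP] : forall w, exists w',
    rho w y != +oo -> rho w w' + rho w' y <= rho w y.
  move=> w; have [->|[w' ww']] := rho_interp w y; last by exists w'.
  by exists w; rewrite eqxx.
pose z n := iter n s x; pose a n := rho (z n) y.
have step n : a n != +oo -> rho (z n) (z n.+1) + a n.+1 <= a n by exact: sP.
have afin n : a n != +oo.
  elim: n => // n IH; rewrite -ltey; apply: le_lt_trans (_ : a n < +oo).
    by apply: le_trans (step n IH); rewrite leeDr.
  by rewrite ltey.
(* The index [(m + k).+1] is strictly beyond [m]: at equal indices the inequality could fail, since
   [rho] need not vanish on the diagonal. *)
have zP m k : rho (z m) (z (m + k).+1) + a (m + k).+1 <= a m.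
  elim: k => [|k IH]; first by rewrite addn0; exact: step.
  apply: le_trans IH; rewrite addnS.
  apply: le_trans (leeD (rho_tri _ (z (m + k).+1) _) (lexx _)) _.
  by rewrite -addeA leeD2l // step.
have [w [_ wcl]] := @mcompact X (z @ \oo) _ filterT.
have wD D : closed D -> (\forall n \near \oo, D (z n)) -> D w.
  by move=> cD nD; apply: cD => U wU; exact: wcl.
have rho_sectl u : lsc (rho u).
  apply: (@lsc_comp _ _ _ (fun v => (u, v)) _ _ rho_lsc).
  by apply: continuous_pair => ?; [exact: cvg_cst|exact: cvg_id].
have rho_sectr u : lsc (rho^~ u).
  apply: (@lsc_comp _ _ _ (fun v => (v, u)) _ _ rho_lsc).
  by apply: continuous_pair => ?; [exact: cvg_id|exact: cvg_cst].
exists w; split; last first.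
  apply: (wD [set v | rho x v + rho v y <= rho x y]).
    by apply: lsc_closed; apply: lsc_add.
  by exists 1%N => // -[//|n] _; exact: (zP 0%N n).
have a_ge n : ereal_inf (range a) <= a n by apply: ereal_inf_lbound; exists n.
have Lfin : ereal_inf (range a) \is a fin_num.
  rewrite ge0_fin_numE; first by apply: le_lt_trans (a_ge 0%N) _; rewrite ltey.
  by apply: le_ereal_inf_tmp => _ [n _ <-]; exact: rho_ge0.
apply/lee_addgt0Pr => eps eps0; rewrite add0e.
have [_ [N _ <-] aN] := lb_ereal_inf_adherent eps0 Lfin.
(* The chain is [rho (z m) (z n) + a n <= a m <= a N < inf a + eps]; since [inf a <= a n], the
   finite infimum cancels. *)
have near_cauchy m n : (N <= m < n)%N -> rho (z m) (z n) <= eps%:E.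
  move=> /andP[Nm mn].
  have aNm : a m <= a N.
    have [->//|Nm'] := eqVneq m N.
    have := zP N (m - N).-1; rewrite addnC -addSn prednK; last first.
      by rewrite subn_gt0 ltn_neqAle eq_sym Nm' Nm.
    by rewrite subnK //; apply: le_trans; rewrite leeDr.
  have := zP m (n - m).-1; rewrite addnC -addSn prednK ?subn_gt0 //.
  rewrite subnK 1?ltnW // => H.
  rewrite -(leeD2rE _ _ Lfin) [leRHS]addeC; apply: le_trans (ltW aN).
  by apply: le_trans aNm; apply: le_trans H; rewrite leeD2l.
(* The two arguments are sent to [w] one at a time, each within a closed sublevel set of a section
   of [rho]. *)
apply: (wD [set v | rho v w <= eps%:E]); first exact: lsc_closed.
exists N => // m /= Nm.
apply: (wD [set v | rho (z m) v <= eps%:E]); first exact: lsc_closed.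
by exists m.+1 => // n /= mn; apply: near_cauchy; rewrite Nm.
Qed.

End Interpolation.

(** * Pushouts, regular monomorphisms and coequivalence relations, read in the opposite category *)

(** Metric domination of every cocone yields the mediating morphism by [mhom_glue]; joint
    surjectivity makes it unique. *)
Lemma glue_pushout (A B C P : metCHsep) (f : mhom A B) (h : mhom A C)
    (p1 : mhom B P) (p2 : mhom C P) :
  jointly_surjective p1 p2 -> mhom_comp p1 f = mhom_comp p2 h ->
  (forall (D : metCHsep) (u : mhom B D) (v : mhom C D),
    mhom_comp u f = mhom_comp v h ->
    forall x y, mdist (copair u v x) (copair u v y) <=
                mdist (copair p1 p2 x) (copair p1 p2 y)) ->
  @is_pullback (op MetCH_sep) B C A f h P p1 p2.
Proof.
move=> ps pfh pd; split=> // D u v /pd uv.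
have [w [w1 w2]] := mhom_glue ps uv; exists w; split=> // w' [w1' w2'].
by apply: (jointly_surjective_epi ps);
  [exact: etrans w1 (esym w1')|exact: etrans w2 (esym w2')].
Qed.

Lemma isometric_coequaliser_op (A B Q : metCHsep) (e : mhom A B)
    (j1 j2 : mhom B Q) :
  isometric e -> mhom_comp j1 e = mhom_comp j2 e ->
  (forall b, j1 b = j2 b -> exists a, e a = b) ->
  @is_coequaliser (op MetCH_sep) Q B A j1 j2 e.
Proof.
move=> ei je jS; split=> // D h /mhom_compE jh.
have [u uE] : exists u : mhom D A, mhom_comp e u = h.
  by apply: isometric_lift => // z; exact/jS/jh.
exists u; split=> // u' uE'; apply: (isometric_monic ei).
exact: etrans uE (esym uE').
Qed.

(** A regular monomorphism is compared with the concrete equaliser [i]: as [e = i v] and [u v = id]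
    with [u] non-expansive, [d(x, y) <= d(v x, v y) = d(e x, e y)]. *)
Lemma regular_epi_op_isometric (B A : metCHsep) (e : mhom A B) :
  @is_regular_epi (op MetCH_sep) B A e <-> isometric e.
Proof.
split=> [[Q [f [g [fg eU]]]] x y|ei]; last first.
  have [Q [j1 [j2 [je jS]]]] := isometric_coincidence ei.
  by exists Q, j1, j2; exact: isometric_coequaliser_op.
have [E [i [ii ifg iU]]] := equaliser_exists f g.
have [v iv] := iU _ e fg.
have [u [eu _]] := eU _ i ifg.
have [w [_ wU]] := eU _ e fg.
have uv : mhom_comp u v = mhom_id A.
  rewrite -(wU (mhom_comp u v)); last first.
    by rewrite -[RHS]iv -[in RHS]eu; exact: mhomP.
  by apply: wU; exact: mhomP.
have uvE z : u (v z) = z by exact: (congr1 (fun k : mhom A A => k z) uv).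
apply/eqP; rewrite eq_le mfun_nonexp /= -{1}[x]uvE -{1}[y]uvE.
apply: le_trans (mfun_nonexp u _ _) _; rewrite -ii.
by rewrite -[e]iv.
Qed.

(** The isometric [j2] of the amalgam factors through [p2] followed by a non-expansive map, so [p2]
    cannot shrink distances. *)
Lemma isometric_pushout (A B C P : metCHsep) (e : mhom A B) (g : mhom A C)
    (p1 : mhom B P) (p2 : mhom C P) :
  isometric e -> @is_pullback (op MetCH_sep) B C A e g P p1 p2 -> isometric p2.
Proof.
move=> ei [_ pU] x y; have [Q [j1 [j2 [jE ji _]]]] := isometric_amalgam g ei.
have [u [[_ u2] _]] := pU Q j1 j2 jE.
have uE z : u (p2 z) = j2 z by exact: (congr1 (fun k : mhom C Q => k z) u2).
apply/eqP; rewrite eq_le mfun_nonexp /= -ji -!uE; exact: mfun_nonexp.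
Qed.

(** The retraction [d] makes [r1] and [r2] isometric and [s] exchanges the two copies of [X], so
    [rho] and the metric of [X] determine that of [Y]. The pair is then the cokernel pair of the
    equaliser [f] of [r1] and [r2]. *)
Lemma coequivalence_effective (X Y : metCHsep) (r1 r2 : mhom X Y) :
  @is_equivalence_relation (op MetCH_sep) X Y r1 r2 ->
  @is_effective (op MetCH_sep) X Y r1 r2.
Proof.
move=> [epi [d [d1 d2]] [s [s1 s2]] trans].
have rs : jointly_surjective r1 r2 by exact: jointly_epi_surjective epi.
have dE1 x : d (r1 x) = x by exact: (congr1 (fun k : mhom X X => k x) d1).
have dE2 x : d (r2 x) = x by exact: (congr1 (fun k : mhom X X => k x) d2).
have sE1 x : s (r1 x) = r2 x by exact: (congr1 (fun k : mhom X Y => k x) s1).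
have sE2 x : s (r2 x) = r1 x by exact: (congr1 (fun k : mhom X Y => k x) s2).
pose rho x y := mdist (r1 x) (r2 y).
have rho_ge0 x y : 0 <= rho x y by exact: mdist_ge0.
have r1i : isometric r1.
  move=> x y; apply/eqP; rewrite eq_le mfun_nonexp /=.
  by have := mfun_nonexp d (r1 x) (r1 y); rewrite !dE1.
have r2i : isometric r2.
  move=> x y; apply/eqP; rewrite eq_le mfun_nonexp /=.
  by have := mfun_nonexp d (r2 x) (r2 y); rewrite !dE2.
have rhoS x y : mdist (r2 x) (r1 y) = rho x y.
  have := mfun_nonexp s (r2 x) (r1 y); have := mfun_nonexp s (r1 x) (r2 y).
  by rewrite sE1 !sE2 sE1 => ? ?; apply/eqP; rewrite eq_le; apply/andP.
have d_rho x y : mdist x y <= rho x y.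
  by have := mfun_nonexp d (r1 x) (r2 y); rewrite dE1 dE2.
have rho_tri x y z : rho x z <= rho x y + rho y z.
  apply: le_trans (mdist_tri _ (r2 y) _) _; rewrite leeD2l //.
  by rewrite r2i.
have rho_lsc : lsc (fun p : X * X => rho p.1 p.2).
  apply: lsc_mdist.
    exact: continuous_compT (@continuous_fst _ _) (@mfun_cont _ _ r1).
  exact: continuous_compT (@continuous_snd _ _) (@mfun_cont _ _ r2).
(* The map [t] sends [r1 x] and [r2 y] to [p1 (r1 x)] and [p2 (r2 y)], whose distance in [P] bounds
   the one in the amalgam [Q]; there it is infinite or equal to [rho x z + rho z y]. *)
have rho_interp x y : rho x y = +oo \/ exists z, rho x z + rho z y <= rho x y.
  have [P [p1 [p2 [ps pE pd]]]] := pushout_exists r2 r1.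
  have pP := glue_pushout ps pE pd.
  have [t [t1 t2]] := trans _ _ _ pP.
  have [Q [j1 [j2 [jE _ jd]]]] := isometric_amalgam r1 r2i.
  have jrho : mdist (j1 (r1 x)) (j2 (r2 y)) <= rho x y.
    apply: le_trans (pd Q j1 j2 jE (inl _) (inr _)) _ => /=.
    have -> : p1 (r1 x) = t (r1 x).
      by apply/esym; exact: (congr1 (fun k : mhom X P => k x) t1).
    have -> : p2 (r2 y) = t (r2 y).
      by apply/esym; exact: (congr1 (fun k : mhom X P => k y) t2).
    exact: mfun_nonexp.
  case: (jd (r1 x) (r2 y)) => [joo|[z jz]].
    by left; apply/eqP; rewrite -leye_eq -joo.
  by right; exists z; rewrite -[leLHS]jz.
have rho0 z : rho z z <= 0 -> r1 z = r2 z.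
  by move=> z0; apply: le0_mdist_eq => //; rewrite rhoS.
have [F [f [fi fr fU]]] := equaliser_exists r1 r2.
(* Only the universal property of [f] is at hand, so the closed subobject of all coincidence points
   is lifted through it. *)
have fS z : r1 z = r2 z -> exists a, f a = z.
  move=> rz.
  have [E [i [_ iS]]] := closed_subobject (@mhom_equaliser_closed _ _ r1 r2).
  have [u uE] : exists u, mhom_comp f u = i.
    apply: fU; apply: mhomP => a.
    by have : range i (i a) by [exists a]; rewrite iS.
  have [a _ az] : range i z by rewrite iS.
  by exists (u a); rewrite -az -uE.
have rho_factor x y :
    rho x y = +oo \/ exists a, mdist x (f a) + mdist (f a) y <= rho x y.
  have [->|[z [z0 zi]]] := self_zero_interpolation rho_ge0 rho_tri rho_lsc
    rho_interp x y; first by left.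
  right; have [a az] := fS z (rho0 z z0); exists a; rewrite az.
  by apply: le_trans zi; rewrite leeD.
(* On mixed pairs the path through [u (f a) = v (f a)] has length at most
   [d(x, f a) + d(f a, y) <= rho x y], unless [rho x y] is infinite. *)
exists F, f; apply: glue_pushout => // D u v /mhom_compE uv [x|x] [y|y] /=.
- by rewrite r1i mfun_nonexp.
- have [roo|[a]] := rho_factor x y.
    by rewrite -[leRHS]/(rho x y) roo leey.
  apply: le_trans; apply: le_trans (mdist_tri _ (u (f a)) _) _.
  by rewrite leeD ?mfun_nonexp // uv mfun_nonexp.
- rewrite rhoS.
  have [roo|[a]] := rho_factor x y; first by rewrite roo leey.
  apply: le_trans; apply: le_trans (mdist_tri _ (v (f a)) _) _.
  by rewrite leeD ?mfun_nonexp // -uv mfun_nonexp.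
- by rewrite r2i mfun_nonexp.
Qed.

Theorem theorem5p16 : barr_coexact MetCH_sep.
Proof.
split; last by move=> X Y r1 r2; exact: coequivalence_effective.
split; first split.
- have [X X0] := empty_object_exists; exists X => Y.
  have c0 : continuous (fun x : X => False_rect Y (X0 x)).
    by move=> x; case: (X0 x).
  have n0 x y : mdist (False_rect Y (X0 x)) (False_rect Y (X0 y)) <= mdist x y.
    by case: (X0 x).
  exists (MHom c0 n0); split=> // g _.
  by apply: mhomP => x; case: (X0 x).
- move=> B C A f h; have [P [p1 [p2 [ps pE pd]]]] := pushout_exists f h.
  by exists P, p1, p2; exact: glue_pushout.
- move=> X A f K k1 k2 _; have [E [i [ii ik iU]]] := equaliser_exists k1 k2.
  exists E, i; split=> // D h kh; have [u uE] := iU D h kh.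
  exists u; split=> // u' uE'; apply: (isometric_monic ii).
  exact: etrans uE (esym uE').
- move=> B C A e g P p1 p2 /regular_epi_op_isometric ei pP.
  exact/regular_epi_op_isometric/(isometric_pushout ei pP).
Qed.
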